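(* (Completeness of QBUA$^\Diamond$ triples.) For all resource functions $P,Q$ that are finitely supported and all commands $C$, if $\vDash_{\mathsf B}^{\Diamond}[P]\,C\,[Q]$ holds, then $\vdash_{\mathsf B}^{\Diamond}[P]\,C\,[Q]$ is derivable with the QBUA$^\Diamond$ rules.
   Context: Commands over integer-valued program variables: $C ::= \mathsf{skip} \mid x:=e \mid \mathsf{assume}(B) \mid \mathsf{tick}(e) \mid C;C \mid C+C \mid C^\star \mid \mathsf{local}\ x\ \mathsf{in}\ C$ ($+$ nondeterministic choice, $C^\star$ nondeterministic iteration). States $\sigma:\mathit{Var}\to\mathbb Z$. Big-step semantics $\langle C,\sigma,p\rangle\Downarrow_l\langle\tau,q\rangle$ (resource $p$ at start, $q$ at end, $l$ minimal level seen): skip/assign/assume (assume requires $B$ true in $\sigma$) leave resource $p$ and have $l=p$; assign updates $x$ to $[\![e]\!]_\sigma$; tick: $\langle\mathsf{tick}(e),\sigma,p\rangle\Downarrow_{\min(p,p-[\![e]\!]_\sigma)}\langle\sigma,p-[\![e]\!]_\sigma\rangle$; seq composes runs with $l=\min(l_1,l_2)$; choice takes a run of either branch; $\langle C^\star,\sigma,p\rangle\Downarrow_p\langle\sigma,p\rangle$ and runs of $C;C^\star$ are runs of $C^\star$; local: from $\langle C,\sigma,p\rangle\Downarrow_l\langle\tau,q\rangle$ infer $\langle\mathsf{local}\ x\ \mathsf{in}\ C,\sigma[x\mapsto v],p\rangle\Downarrow_l\langle\tau[x\mapsto v],q\rangle$. $\Downarrow$ means $\exists l$; $\Downarrow^{\le0}$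 means $\exists l\le 0$. Resource functions $P:\mathit{State}\to\mathbb Z\cup\{\pm\infty\}$; pointwise $\min,\max,+,-$; $\mathsf{Sup}\,x.P:=\lambda\sigma.\sup_v P(\sigma[x\mapsto v])$; $P\preceq Q$ pointwise $\le$; $[B](\sigma)=+\infty$ if $B$ holds, else $-\infty$; $\mathrm{fv}$, $\mathrm{mod}(C)$ free/modified variables. Semantics: $\vDash_{\mathsf B}^{\Diamond}[P]C[Q]$ iff for all $\sigma$ and $p\le P(\sigma)$ there exist $\tau$, $q\le Q(\tau)$ with $\langle C,\sigma,p\rangle\Downarrow^{\le0}\langle\tau,q\rangle$. QBUA rules ($\vdash_{\mathsf B}$, used as premises): $[P]\mathsf{skip}[P]$; $[P]\,x:=e\,[\mathsf{Sup}\,x'.\min(P[x'/x],[x=e[x'/x]])]$; $[\min(P,[B])]\mathsf{assume}(B)[\min(P,[B])]$; $[P]\mathsf{tick}(e)[P-e]$; seq; choice; loop (from $\forall n<k.[P(n)]C[P(n+1)]$ get $[P(0)]C^\star[P(k)]$); local with $\mathsf{Sup}$; disjunction giving $[\lambda\sigma.\sup_{i}P_i(\sigma)]C[\lambda\sigma.\sup_iQ_i(\sigma)]$; constancy with $\min(\cdot,[B])$ when $\mathrm{fv}(B)\cap\mathrm{mod}(C)=\emptyset$; relax $[P+F]C[Q+F]$ when $\mathrm{fv}(F)\cap\mathrm{mod}(C)=\emptyset$; consequence ($P\preceq P'$, $[P']C[Q']$, $Q'\preceq Q$); substitution ($y$ fresh). QBUA$^\Diamond$ rules ($\vdash^\Diamond_{\mathsf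 B}$): if $P\preceq0$: $[P]\mathsf{skip}[P]$, $[P]\,x:=e\,[\mathsf{Sup}\,x'.\min(P[x'/x],[x=e[x'/x]])]$, $[\min(P,[B])]\mathsf{assume}(B)[\min(P,[B])]$, $[P]C^\star[P]$; if $\min(P,P-e)\preceq0$: $[P]\mathsf{tick}(e)[P-e]$; SeqL: from $\vdash^\Diamond_{\mathsf B}[P]C_1[R]$ and $\vdash_{\mathsf B}[R]C_2[Q]$ get $\vdash^\Diamond_{\mathsf B}[P]C_1;C_2[Q]$; SeqR: from $\vdash_{\mathsf B}[P]C_1[R]$ and $\vdash^\Diamond_{\mathsf B}[R]C_2[Q]$ likewise; choice from either branch; Loop: from $\forall n<k.\vdash_{\mathsf B}[P(n)]C[P(n+1)]$ and $\exists m<k.\vdash^\Diamond_{\mathsf B}[P(m)]C[P(m+1)]$ get $\vdash^\Diamond_{\mathsf B}[P(0)]C^\star[P(k)]$; local with $\mathsf{Sup}$; disjunction: from $\forall i\in I.[P_i]C[Q_i]$ get $[\lambda\sigma.\sup_{i\in I}P_i(\sigma)]C[\lambda\sigma.\sup_{i\in I}Q_i(\sigma)]$; constancy with $\min(\cdot,[B])$; relax $[P+F]C[Q+F]$ if $\mathrm{fv}(F)\cap\mathrm{mod}(C)=\emptyset$ and $F\preceq0$; consequence ($P\preceq P'$, $Q'\preceq Q$); substitution ($y\notin\mathrm{fv}(P)\cup\mathrm{fv}(Q)\cup\mathrm{fv}(C)$). *)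

(* Defs.v *)
From mathcomp Require Import all_boot all_order all_algebra.
From mathcomp Require Import boolp classical_sets constructive_ereal.

Set Implicit Arguments.
Unset Strict Implicit.
Unset Printing Implicit Defensive.

Import Order.TTheory GRing.Theory Num.Theory.
Local Open Scope classical_set_scope.
Local Open Scope ring_scope.

Definition var := nat.

Definition upd (T : Type) (f : var -> T) (x : var) (v : T) : var -> T :=
  fun y => if y == x then v else f y.

Definition state := var -> int.

(* The syntax of expressions is a parameter: a language of integer and boolean
   expressions is given by its evaluation functions, the (finite) set of free
   variables of an expression, and the renaming of its variables. *)
Record exprLang := ExprLang {
  aexp : Type;
  bexp : Type;
  aeval : aexp -> state -> int;
  beval : bexp -> state -> bool;
  afv : aexp -> seq var;
  bfv : bexp -> seq var;
  aren : (var -> var) -> aexp -> aexp;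
  bren : (var -> var) -> bexp -> bexp;
  aeval_fv : forall (e : aexp) (s t : state),
    {in afv e, s =1 t} -> aeval e s = aeval e t;
  beval_fv : forall (B : bexp) (s t : state),
    {in bfv B, s =1 t} -> beval B s = beval B t;
  aeval_ren : forall r e s, aeval (aren r e) s = aeval e (s \o r);
  beval_ren : forall r B s, beval (bren r B) s = beval B (s \o r);
  afv_ren : forall r e, afv (aren r e) =i map r (afv e);
  bfv_ren : forall r B, bfv (bren r B) =i map r (bfv B)
}.

Inductive cmd (L : exprLang) : Type :=
| Skip
| Assign of var & aexp L
| Assume of bexp L
| Tick of aexp L
| Seq of cmd L & cmd L
| Choice of cmd L & cmd L
| Star of cmd L
| Local of var & cmd L.

Arguments Skip {L}.

Fixpoint cfv (L : exprLang) (C : cmd L) : seq var :=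
  match C with
  | Skip => [::]
  | Assign x e => x :: afv e
  | Assume B => bfv B
  | Tick e => afv e
  | Seq C1 C2 | Choice C1 C2 => cfv C1 ++ cfv C2
  | Star C => cfv C
  | Local x C => [seq y <- cfv C | y != x]
  end.

Fixpoint cmod (L : exprLang) (C : cmd L) : seq var :=
  match C with
  | Skip | Assume _ | Tick _ => [::]
  | Assign x _ => [:: x]
  | Seq C1 C2 | Choice C1 C2 => cmod C1 ++ cmod C2
  | Star C => cmod C
  | Local x C => [seq y <- cmod C | y != x]
  end.

Definition fresh (s : seq var) : var := (foldr maxn 0%N s).+1.

(* Capture-avoiding simultaneous renaming of the free variables: the bound
   variable of [Local] is itself renamed only when it would capture. *)
Fixpoint cren (L : exprLang) (r : var -> var) (C : cmd L) : cmd L :=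
  match C with
  | Skip => Skip
  | Assign x e => Assign (r x) (aren r e)
  | Assume B => Assume (bren r B)
  | Tick e => Tick (aren r e)
  | Seq C1 C2 => Seq (cren r C1) (cren r C2)
  | Choice C1 C2 => Choice (cren r C1) (cren r C2)
  | Star C => Star (cren r C)
  | Local x C =>
      let avoid := [seq r y | y <- cfv C & y != x] in
      let z := if x \in avoid then fresh avoid else x in
      Local z (cren (upd r x z) C)
  end.

(* [single x y] is the renaming y/x. *)
Definition single (x y : var) : var -> var := upd id x y.

(* [bigstep C s p l t q]: C runs from state s with resource p to state t with
   resource q, and l is the least resource level seen along the run. *)
Inductive bigstep (L : exprLang) :
    cmd L -> state -> int -> int -> state -> int -> Prop :=
| BSkip s p : bigstep Skip s p p s p
| BAssign x e s p : bigstep (Assign x e) s p p (upd s x (aeval e s)) p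
| BAssume B s p : beval B s -> bigstep (Assume B) s p p s p
| BTick e s p :
    bigstep (Tick e) s p (Num.min p (p - aeval e s)) s (p - aeval e s)
| BSeq C1 C2 s p l1 u r l2 t q :
    bigstep C1 s p l1 u r -> bigstep C2 u r l2 t q ->
    bigstep (Seq C1 C2) s p (Num.min l1 l2) t q
| BChoiceL C1 C2 s p l t q :
    bigstep C1 s p l t q -> bigstep (Choice C1 C2) s p l t q
| BChoiceR C1 C2 s p l t q :
    bigstep C2 s p l t q -> bigstep (Choice C1 C2) s p l t q
| BStar0 C s p : bigstep (Star C) s p p s p
| BStarS C s p l t q :
    bigstep (Seq C (Star C)) s p l t q -> bigstep (Star C) s p l t q
| BLocal x C s p l t q v :
    bigstep C s p l t q -> bigstep (Local x C) (upd s x v) p l (upd t x v) q.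

Definition resfun := state -> \bar int.

(* [ereal_sup] is only available over a field; [esupP] below shows that this is
   the least upper bound in Z with -oo and +oo (and esup set0 = -oo). *)
Definition esup (A : set (\bar int)) : \bar int := supremum -oo%E A.

Lemma esupP (A : set (\bar int)) : supremums A (esup A).
Proof.
have [->|/set0P A0] := eqVneq A set0.
  rewrite /esup supremum0; split; first by move=> y [].
  by move=> y _; exact: leNye.
suff [m Am] : supremums A !=set0.
  rewrite /esup /supremum ifF; last by apply/negbTE/set0P.
  by apply: xgetPex; exists m.
have [Apy|Apy] := pselect (A +oo%E).
  by exists +oo%E; split=> [y _|y]; [exact: leey|exact].
have [[k ub]|nub] := pselect (exists k : int, ubound A k%:E); last first.
  exists +oo%E; split=> [y _|[k||] //]; first exact: leey.
    by move=> ub; case: nub; exists k.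
  move=> ub; case: nub; exists 0 => y /ub; rewrite leeNy_eq => /eqP ->.
  exact: leNye.
have [[a Aa]|nA] := pselect (exists a : int, A a%:E); last first.
  exists -oo%E; split=> [[y||] // Ay|y _]; [by case: nA; exists y| exact: leNye].
pose P n := `[< A (k - n%:Z)%:E >].
have exP : exists n, P n.
  exists `|k - a|%N; apply/asboolP; rewrite gez0_abs.
    by rewrite opprB addrC subrK.
  by rewrite subr_ge0 -lee_fin; exact: ub.
case: (ex_minnP exP) => n /asboolP An nmin.
exists (k - n%:Z)%:E; split; last by move=> y; exact.
move=> [b||] // Ab; last exact: leNye.
have bk : b <= k by rewrite -lee_fin; exact: ub.
have : P `|k - b|%N.
  by apply/asboolP; rewrite gez0_abs ?subr_ge0// opprB addrC subrK.
move=> /nmin; rewrite -lez_nat gez0_abs ?subr_ge0// => h.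
by rewrite lee_fin lerBrDr addrC -lerBrDr.
Qed.

Definition rle (P Q : resfun) : Prop := forall s, (P s <= Q s)%E.
Definition rmin (P Q : resfun) : resfun := fun s => Order.min (P s) (Q s).
(* In [\bar int], +oo + -oo = -oo. *)
Definition radd (P Q : resfun) : resfun := fun s => (P s + Q s)%E.
Definition rzero : resfun := fun=> 0%E.
(* P - e *)
Definition rsub (L : exprLang) (P : resfun) (e : aexp L) : resfun :=
  fun s => (P s - (aeval e s)%:E)%E.
(* [B] *)
Definition rind (b : state -> bool) : resfun :=
  fun s => if b s then +oo%E else -oo%E.
(* P[y/x] *)
Definition rren (P : resfun) (x y : var) : resfun := fun s => P (upd s x (s y)).
(* Sup x. P *)
Definition rSup (x : var) (P : resfun) : resfun :=
  fun s => esup (range (fun v : int => P (upd s x v))).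
Definition rsup (I : Type) (P : I -> resfun) : resfun :=
  fun s => esup (range (fun i => P i s)).

Definition rfv (P : resfun) : set var :=
  [set x | exists s v, P (upd s x v) <> P s].

Definition finitely_supported (P : resfun) : Prop :=
  exists X : seq var, forall s t : state, {in X, s =1 t} -> P s = P t.

(* Sup x'. min(P[x'/x], [x = e[x'/x]]) *)
Definition assign_post (L : exprLang) (P : resfun) (x : var) (e : aexp L)
    (x' : var) : resfun :=
  rSup x' (rmin (rren P x x')
                (rind (fun s => s x == aeval (aren (single x x') e) s))).

(* x' is a fresh bound variable for the assignment axiom. *)
Definition assign_fresh (L : exprLang) (P : resfun) (x : var) (e : aexp L)
    (x' : var) : Prop :=
  [/\ x' != x, x' \notin afv e & ~ rfv P x'].

Definition valid_dia (L : exprLang) (P : resfun) (C : cmd L) (Q : resfun) :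
    Prop :=
  forall (s : state) (p : int), (p%:E <= P s)%E ->
  exists (t : state) (q : int), (q%:E <= Q t)%E /\
  exists l : int, l <= 0 /\ bigstep C s p l t q.

Inductive qbua (L : exprLang) : resfun -> cmd L -> resfun -> Prop :=
| QSkip P : qbua P Skip P
| QAssign P x e x' : assign_fresh P x e x' ->
    qbua P (Assign x e) (assign_post P x e x')
| QAssume P B :
    qbua (rmin P (rind (beval B))) (Assume B) (rmin P (rind (beval B)))
| QTick P e : qbua P (Tick e) (rsub P e)
| QSeq P R Q C1 C2 : qbua P C1 R -> qbua R C2 Q -> qbua P (Seq C1 C2) Q
| QChoiceL P Q C1 C2 : qbua P C1 Q -> qbua P (Choice C1 C2) Q
| QChoiceR P Q C1 C2 : qbua P C2 Q -> qbua P (Choice C1 C2) Q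
| QLoop (P : nat -> resfun) (k : nat) C :
    (forall n, (n < k)%N -> qbua (P n) C (P n.+1)) ->
    qbua (P 0%N) (Star C) (P k)
| QLocal P Q x C : qbua P C Q -> qbua (rSup x P) (Local x C) (rSup x Q)
| QDisj (I : Type) (P Q : I -> resfun) C :
    (forall i, qbua (P i) C (Q i)) -> qbua (rsup P) C (rsup Q)
| QConstancy P Q C (B : bexp L) :
    (forall x, x \in bfv B -> x \notin cmod C) -> qbua P C Q ->
    qbua (rmin P (rind (beval B))) C (rmin Q (rind (beval B)))
| QRelax P Q F C :
    (forall x, rfv F x -> x \notin cmod C) -> qbua P C Q ->
    qbua (radd P F) C (radd Q F)
| QCons P P' Q Q' C : rle P P' -> qbua P' C Q' -> rle Q' Q -> qbua P C Q
| QSubst P Q C x y :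
    ~ rfv P y -> ~ rfv Q y -> y \notin cfv C -> qbua P C Q ->
    qbua (rren P x y) (cren (single x y) C) (rren Q x y).

Inductive qbua_dia (L : exprLang) : resfun -> cmd L -> resfun -> Prop :=
| DSkip P : rle P rzero -> qbua_dia P Skip P
| DAssign P x e x' : rle P rzero -> assign_fresh P x e x' ->
    qbua_dia P (Assign x e) (assign_post P x e x')
| DAssume P B : rle P rzero ->
    qbua_dia (rmin P (rind (beval B))) (Assume B) (rmin P (rind (beval B)))
| DTick P e : rle (rmin P (rsub P e)) rzero -> qbua_dia P (Tick e) (rsub P e)
| DSeqL P R Q C1 C2 :
    qbua_dia P C1 R -> qbua R C2 Q -> qbua_dia P (Seq C1 C2) Q
| DSeqR P R Q C1 C2 :
    qbua P C1 R -> qbua_dia R C2 Q -> qbua_dia P (Seq C1 C2) Q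
| DChoiceL P Q C1 C2 : qbua_dia P C1 Q -> qbua_dia P (Choice C1 C2) Q
| DChoiceR P Q C1 C2 : qbua_dia P C2 Q -> qbua_dia P (Choice C1 C2) Q
| DLoop0 P C : rle P rzero -> qbua_dia P (Star C) P
| DLoop (P : nat -> resfun) (k m : nat) C :
    (forall n, (n < k)%N -> qbua (P n) C (P n.+1)) ->
    (m < k)%N -> qbua_dia (P m) C (P m.+1) ->
    qbua_dia (P 0%N) (Star C) (P k)
| DLocal P Q x C : qbua_dia P C Q -> qbua_dia (rSup x P) (Local x C) (rSup x Q)
| DDisj (I : Type) (P Q : I -> resfun) C :
    (forall i, qbua_dia (P i) C (Q i)) -> qbua_dia (rsup P) C (rsup Q)
| DConstancy P Q C (B : bexp L) :
    (forall x, x \in bfv B -> x \notin cmod C) -> qbua_dia P C Q ->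
    qbua_dia (rmin P (rind (beval B))) C (rmin Q (rind (beval B)))
| DRelax P Q F C :
    (forall x, rfv F x -> x \notin cmod C) -> rle F rzero -> qbua_dia P C Q ->
    qbua_dia (radd P F) C (radd Q F)
| DCons P P' Q Q' C :
    rle P P' -> qbua_dia P' C Q' -> rle Q' Q -> qbua_dia P C Q
| DSubst P Q C x y :
    ~ rfv P y -> ~ rfv Q y -> y \notin cfv C -> qbua_dia P C Q ->
    qbua_dia (rren P x y) (cren (single x y) C) (rren Q x y).

(* Main.v *)
(** A precondition P lies below the supremum of the "point" resource functions
    at the pairs (s, p) with p <= P s, where the point at (s, p) takes the value
    p on the states that agree with s on a finite set X of variables, and -oo
    elsewhere. By the disjunction rule it is enough to treat points, and for X
    containing the free variables of C, every run of C from (s, p) to (t, q)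
    yields a derivable triple between the corresponding points, by induction on
    C. A local variable may also belong to X: its outer value is then restored by
    the relax rule, with a frame that is 0 where the variable has that value and
    -oo elsewhere. *)

From mathcomp Require Import all_boot all_order all_algebra.
From mathcomp Require Import boolp classical_sets constructive_ereal.
Require Import Defs.

Set Implicit Arguments.
Unset Strict Implicit.
Unset Printing Implicit Defensive.

Import Order.TTheory GRing.Theory Num.Theory.
Local Open Scope classical_set_scope.
Local Open Scope ring_scope.

Lemma le_esup (A : set (\bar int)) y : A y -> (y <= esup A)%E.
Proof. by move=> Ay; exact: (esupP A).1. Qed.

Lemma esup_le (A : set (\bar int)) y : ubound A y -> (esup A <= y)%E.
Proof. by move=> Ay; exact: (esupP A).2. Qed.

Lemma rle_refl (P : resfun) : rle P P.
Proof. by move=> s. Qed.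

Lemma fresh_notin (s : seq var) : fresh s \notin s.
Proof.
have le y : y \in s -> (y <= foldr maxn 0 s)%N.
  elim: s => //= a s IH; rewrite inE leq_max => /orP[/eqP ->|/IH ->].
    by rewrite leqnn.
  by rewrite orbT.
by apply/negP => /le; rewrite /fresh ltnn.
Qed.

(** The minimum along a run includes its final resource. This serves loops in which no iteration
    follows the first. *)
Lemma bigstep_level_le (L : exprLang) (C : cmd L) s p l t q :
  bigstep C s p l t q -> l <= q.
Proof.
elim=> // *; first by rewrite ge_min lexx orbT.
by rewrite ge_min; apply/orP; right.
Qed.

Definition agree (X : seq var) (s t : state) : bool :=
  all (fun y => s y == t y) X.

Lemma agreeP (X : seq var) (s t : state) :
  reflect {in X, s =1 t} (agree X s t).
Proof. by apply: (iffP allP) => h y /h => [/eqP|->]. Qed.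

Definition pt (X : seq var) (s : state) (p : int) : resfun :=
  fun u => if agree X u s then p%:E else -oo%E.

Lemma pt_le (X : seq var) s p (Q : resfun) :
  (forall u, {in X, u =1 s} -> (p%:E <= Q u)%E) -> rle (pt X s p) Q.
Proof.
by move=> h u; rewrite /pt; case: agreeP => [/h //|_]; exact: leNye.
Qed.

Lemma pt_le0 (X : seq var) s p : p <= 0 -> rle (pt X s p) rzero.
Proof. by move=> p0; apply: pt_le => u _; rewrite lee_fin. Qed.

Lemma pt_agree (X : seq var) s p u : {in X, u =1 s} -> pt X s p u = p%:E.
Proof. by move=> h; rewrite /pt (introT (agreeP _ _ _) h). Qed.

Lemma rfv_pt (X : seq var) s p x : x \notin X -> ~ rfv (pt X s p) x.
Proof.
move=> xX [u [v]]; apply; rewrite /pt /agree; congr (if _ then _ else _).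
apply: eq_in_all => y yX; rewrite /upd; case: (eqVneq y x) => // yx.
by rewrite -yx yX in xX.
Qed.

(** The bound [x'] stands for the old value of [x]. Unless the minimum is [-oo], putting that value
    back gives a state that agrees with [s] on [X], so the current [x] is the value of [e] in
    [s]. *)
Lemma assign_post_pt_le (L : exprLang) (X : seq var) s p x (e : aexp L) x' :
  {subset afv e <= X} -> x' \notin X ->
  rle (assign_post (pt X s p) x e x') (pt X (upd s x (aeval e s)) p).
Proof.
move=> eX x'X u; apply: esup_le => _ [v _ <-].
rewrite /rmin /rren /pt; case: agreeP => [h|_]; last first.
  by rewrite ge_min leNye.
have upx y : y \in X -> (y == x') = false.
  by move=> yX; apply/eqP => yx; rewrite -yx yX in x'X.
rewrite /rind aeval_ren; case: eqP => [|_]; last by rewrite ge_min leNye orbT.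
move=> ux; rewrite [X in (_ <= X)%E]ifT ?ge_min ?lexx //.
apply/agreeP => y yX; rewrite /upd; case: eqP => [yx|/eqP yx]; last first.
  by have := h y yX; rewrite /upd (negbTE yx) upx.
move: ux; rewrite /upd -yx upx // => ->; apply: aeval_fv => z ze.
have := h z (eX z ze); rewrite /upd /single /comp /upd -yx.
by case: (z == y); rewrite ?eqxx.
Qed.

Lemma rsub_pt (L : exprLang) (X : seq var) s p (e : aexp L) :
  {subset afv e <= X} -> rsub (pt X s p) e = pt X s (p - aeval e s).
Proof.
move=> eX; apply: funext => u; rewrite /rsub /pt; case: agreeP => // us.
by rewrite (aeval_fv (t := s)) // => y /eX /us.
Qed.

Lemma rmin_pt_assume (L : exprLang) (X : seq var) s p (B : bexp L) :
  {subset bfv B <= X} -> beval B s ->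
  rmin (pt X s p) (rind (beval B)) = pt X s p.
Proof.
move=> BX Bs; apply: funext => u; rewrite /rmin /rind /pt.
case: agreeP => [us|_]; last by apply/min_idPl; exact: leNye.
rewrite (beval_fv (t := s)) ?Bs; last by move=> y /BX /us.
by apply/min_idPl; exact: leey.
Qed.

(** For [x] outside [X] a point over [X] leaves [x] free, so the guard is then constantly 0. *)
Definition rguard (X : seq var) (x : var) (v : int) : resfun :=
  fun s => if (x \in X) ==> (s x == v) then 0%E else -oo%E.

Lemma rguard_le0 X x v : rle (rguard X x v) rzero.
Proof. by move=> s; rewrite /rguard; case: ifP => // _; exact: leNye. Qed.

Lemma rfv_rguard X x v y : rfv (rguard X x v) y -> y = x.
Proof.
move=> [s [w]]; rewrite /rguard /upd.
by case: (eqVneq x y) => [->|].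
Qed.

Lemma pt_le_local (X : seq var) s p x v :
  rle (pt X (upd s x v) p) (radd (rSup x (pt (x :: X) s p)) (rguard X x v)).
Proof.
apply: pt_le => u us; rewrite /radd /rguard.
have -> : (x \in X) ==> (u x == v).
  by apply/implyP => /us ->; rewrite /upd eqxx.
(* The witness is the inner value of [x], at which the body starts. *)
rewrite adde0; apply: le_esup; exists (s x) => //; apply: pt_agree => y.
rewrite inE /upd; case: (eqVneq y x) => [->//|yx /us ->].
by rewrite /upd (negbTE yx).
Qed.

Lemma local_le_pt (X : seq var) s p x v :
  rle (radd (rSup x (pt (x :: X) s p)) (rguard X x v)) (pt X (upd s x v) p).
Proof.
move=> u; rewrite /radd /rguard; case: implyP => [ux|_]; last first.
  by rewrite addeNy; exact: leNye.
rewrite adde0; apply: esup_le => _ [w _ <-].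
rewrite {1}/pt; case: agreeP => [h|_]; last exact: leNye.
rewrite pt_agree // => y yX; rewrite /upd; case: (eqVneq y x) => [yx|yx].
  by rewrite yx; apply/eqP/ux; rewrite -yx.
by have := h y; rewrite inE yX orbT /upd (negbTE yx) => ->.
Qed.

Section RunDerivation.
Variable L : exprLang.
Implicit Types C : cmd L.

(** The plain triple is carried along because sequencing and loops use the diamond at one place and
    plain triples at the others. *)
Definition run_derivable C (X : seq var) s p (l : int) t q : Prop :=
  qbua (pt X s p) C (pt X t q) /\
  (l <= 0 -> qbua_dia (pt X s p) C (pt X t q)).

(** No rule unrolls a loop, so the triples of its iterations are collected in a chain [F] for the
    loop rule. The case [k = 0] is left to [DLoop0], whence [p <= 0]. *)
Definition iter_derivable C (X : seq var) s p (l : int) t q : Prop :=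
  exists k, exists F : nat -> resfun,
  [/\ F 0%N = pt X s p, F k = pt X t q,
      forall n, (n < k)%N -> qbua (F n) C (F n.+1)
    & l <= 0 -> (k = 0%N /\ p <= 0) \/
                exists2 m, (m < k)%N & qbua_dia (F m) C (F m.+1)].

Lemma iter_derivable_star C X s p l t q :
  iter_derivable C X s p l t q -> run_derivable (Star C) X s p l t q.
Proof.
move=> [k [F [F0 Fk FS Fl]]]; split; first by rewrite -F0 -Fk; exact: QLoop.
move=> /Fl[[k0 p0]|[m mk Fm]].
  by rewrite -Fk k0 F0; apply/DLoop0/pt_le0.
by rewrite -F0 -Fk; exact: DLoop Fm.
Qed.

Lemma iter_derivable_cons C X s p l1 u r l2 t q :
  l1 <= r -> run_derivable C X s p l1 u r -> iter_derivable C X u r l2 t q ->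
  iter_derivable C X s p (Num.min l1 l2) t q.
Proof.
move=> l1r [d1 dd1] [k [F [F0 Fk FS Fl]]].
exists k.+1, (fun n => if n is n'.+1 then F n' else pt X s p); split=> //.
  by case=> [|n] //; [rewrite F0 | exact: FS].
have first_dia : l1 <= 0 -> exists2 m, (m < k.+1)%N &
    qbua_dia (if m is n'.+1 then F n' else pt X s p) C (F m).
  by move=> l10; exists 0%N => //; rewrite F0; exact: dd1.
rewrite ge_min => /orP[/first_dia|/Fl[[_ r0]|[m mk Fm]]]; right=> //.
  (* The remaining loop is empty with [r <= 0]; as [l1 <= r], the first iteration already reaches a
     level at most 0. *)
  exact: first_dia (le_trans l1r r0).
by exists m.+1.
Qed.

(* Both shapes of command are needed at once, because [BStarS] goes through
   [Seq C (Star C)]. *)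
Lemma bigstep_star_derivable C X :
  (forall s p l t q, bigstep C s p l t q -> run_derivable C X s p l t q) ->
  forall D s p l t q, bigstep D s p l t q ->
  (D = Star C -> iter_derivable C X s p l t q) /\
  (D = Seq C (Star C) -> iter_derivable C X s p l t q).
Proof.
move=> HC D s p l t q; elim=> {D s p l t q} //.
- move=> C1 C2 s p l1 u r l2 t q b1 _ b2 [IH2 _]; split=> // -[e1 e2].
  rewrite e1 in b1; apply: iter_derivable_cons (IH2 e2); last exact: HC.
  exact: bigstep_level_le b1.
- by move=> D s p; split=> // _; exists 0%N, (fun=> pt X s p); split=> //; left.
- by move=> D s p l t q _ [_ IH]; split=> // -[eD]; apply: IH; rewrite eD.
Qed.

(** The guard is framed outside the block, where [x] does not count as modified even if [C] assigns
    it. *)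
Lemma run_derivable_local x C X s p l t q v :
  run_derivable C (x :: X) s p l t q ->
  run_derivable (Local x C) X (upd s x v) p l (upd t x v) q.
Proof.
have fr y : rfv (rguard X x v) y -> y \notin cmod (Local x C).
  by move=> /rfv_rguard ->; rewrite /= mem_filter eqxx.
move=> [d dd]; split=> [|/dd {}dd].
  apply: QCons (@pt_le_local X s p x v) _ (@local_le_pt X t q x v).
  exact: QRelax fr (QLocal x d).
apply: DCons (@pt_le_local X s p x v) _ (@local_le_pt X t q x v).
exact: DRelax fr (@rguard_le0 X x v) (DLocal x dd).
Qed.

(** The induction generalizes [X], since the body of a local block is treated over [x :: X]. *)
Lemma bigstep_derivable C (X : seq var) s p l t q :
  {subset cfv C <= X} -> bigstep C s p l t q -> run_derivable C X s p l t q.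
Proof.
elim: C X s p l t q => [|x e|B|e|C1 IH1 C2 IH2|C1 IH1 C2 IH2|C IH|x C IH]
  X s p l t q /= CX b.
- inversion b; subst; split=> [|l0]; first exact: QSkip.
  exact/DSkip/pt_le0.
- have eX : {subset afv e <= X} by move=> y ye; apply: CX; rewrite inE ye orbT.
  pose x' := fresh X; have x'X : x' \notin X by exact: fresh_notin.
  have fr : assign_fresh (pt X s p) x e x'.
    split; last exact: rfv_pt.
      by apply/eqP => xx; rewrite xx CX ?mem_head in x'X.
    by apply/negP => /eX; exact/negP.
  inversion b; subst; split=> [|l0].
    exact: (QCons (@rle_refl _) (QAssign fr) (assign_post_pt_le _ _ _ eX x'X)).
  exact: (DCons (@rle_refl _) (DAssign (pt_le0 _ _ l0) fr)
                (assign_post_pt_le _ _ _ eX x'X)).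
- inversion b; subst; rewrite /run_derivable -(rmin_pt_assume (s:=t) q CX) //.
  by split=> [|l0]; [exact: QAssume | exact/DAssume/pt_le0].
- inversion b; subst; rewrite /run_derivable -rsub_pt //.
  split=> [|l0]; first exact: QTick.
  (* On states agreeing with the start, the side condition of the rule is exactly that the level of
     the tick is at most 0. *)
  apply: DTick => u; rewrite rsub_pt // /rmin /pt; case: ifP => _.
    by rewrite -EFin_min lee_fin.
  by rewrite minxx; exact: leNye.
- have X1 : {subset cfv C1 <= X} by move=> y h; apply: CX; rewrite mem_cat h.
  have X2 : {subset cfv C2 <= X}.
    by move=> y h; apply: CX; rewrite mem_cat h orbT.
  inversion b as [| | | |? ? ? ? l1 u r l2 ? ? b1 b2| | | | |]; subst.
  have [d1 dd1] := IH1 X _ _ _ _ _ X1 b1.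
  have [d2 dd2] := IH2 X _ _ _ _ _ X2 b2.
  split; first exact: QSeq d1 d2.
  rewrite ge_min => /orP[/dd1|/dd2] d; [exact: DSeqL d d2 | exact: DSeqR d1 d].
- have X1 : {subset cfv C1 <= X} by move=> y h; apply: CX; rewrite mem_cat h.
  have X2 : {subset cfv C2 <= X}.
    by move=> y h; apply: CX; rewrite mem_cat h orbT.
  inversion b as [| | | | |? ? ? ? ? ? ? b1|? ? ? ? ? ? ? b1| | |]; subst.
    have [d dd] := IH1 X _ _ _ _ _ X1 b1.
    by split=> [|/dd]; [exact: QChoiceL|exact: DChoiceL].
  have [d dd] := IH2 X _ _ _ _ _ X2 b1.
  by split=> [|/dd]; [exact: QChoiceR|exact: DChoiceR].
- apply: iter_derivable_star.
  by apply: (bigstep_star_derivable _ b).1 => // *; exact: IH.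
- inversion b as [| | | | | | | | |? ? s0 ? ? t0 ? v b1]; subst.
  apply: run_derivable_local; apply: IH b1 => y yC; rewrite inE.
  by case: (eqVneq y x) => //= yx; apply: CX; rewrite mem_filter yx.
Qed.

End RunDerivation.

(** Where [P s] is [+oo], every integer [p] gives an index [(s, p)], so the supremum there is
    neither an integer nor [-oo]. *)
Lemma le_sup_pt (X : seq var) (P : resfun) :
  rle P (rsup (fun i : {sp : state * int | (sp.2%:E <= P sp.1)%E} =>
                 pt X (sval i).1 (sval i).2)).
Proof.
move=> s.
have le_sup p : (p%:E <= P s)%E -> (p%:E <= rsup
    (fun i : {sp : state * int | (sp.2%:E <= P sp.1)%E} =>
       pt X (sval i).1 (sval i).2) s)%E.
  move=> pP; apply: le_esup; exists (exist _ (s, p) pP) => //=.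
  exact: pt_agree.
case: (P s) le_sup => [p||] le_sup; [exact: le_sup| |exact: leNye].
case: (rsup _ s) le_sup => [m||] le_sup //.
  by have := le_sup (m + 1) (leey _); rewrite lee_fin gerDl ler10.
by have := le_sup 0 (leey _).
Qed.

Theorem theorem4 (L : exprLang) (P Q : resfun) (C : cmd L) :
  finitely_supported P -> finitely_supported Q ->
  valid_dia P C Q -> qbua_dia P C Q.
Proof.
(* Including [XQ] lets [q <= Q t] pass to all states that agree with [t] on [X], which puts the
   final point below [Q]. *)
move=> _ [XQ fQ] PQ; pose X := cfv C ++ XQ.
apply: (DCons (@le_sup_pt X P) (Q' := rsup (fun=> Q : resfun))).
  apply: DDisj => -[[s p] /= pP].
  have [t [q [qQ [l [l0 b]]]]] := PQ s p pP.
  have CX : {subset cfv C <= X} by move=> y yC; rewrite mem_cat yC.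
  have [_ /(_ l0) d] := bigstep_derivable CX b.
  apply: DCons (@rle_refl _) d _; apply: pt_le => u ut.
  by rewrite (fQ u t) // => y yX; apply: ut; rewrite mem_cat yX orbT.
by move=> s; apply: esup_le => _ [i _ <-].
Qed.
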